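(* For each integer $i>0$ let $S(i)$ denote the smallest positive integer with span equal to $i$. Then \[ S(3)=103,\qquad S(4)=4985,\qquad S(5)=641687,\qquad S(6)=326552783. \]
   Context: A $\{2,3\}$-integer is a positive or negative (nonzero) integer with no prime divisors other than $2$ or $3$; that is, an integer of the form $\pm 2^a3^b$ with $a,b\ge 0$ (so $\pm 1$ are included). A length-$r$ double-base representation of an integer $n$ is an expression $n=n_1+\cdots+n_r$ in which each $n_i$ is a $\{2,3\}$-integer (repetitions allowed). The span of an integer $n$ is the smallest $r$ such that $n$ has a double-base representation of length $r$. *)

(* Defs.v *)
From Stdlib Require Import ZArith Znumtheory List Lia Classical Wf_nat.
Import ListNotations.
Open Scope Z_scope.

Definition two_three_integer (m : Z) : Prop :=
  m <> 0 /\ forall p : Z, prime p -> (p | m) -> p = 2 \/ p = 3.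

Definition double_base_representation (r : nat) (l : list Z) (n : Z) : Prop :=
  length l = r /\ Forall two_three_integer l /\ fold_right Z.add 0 l = n.

Definition has_representation (n : Z) (r : nat) : Prop :=
  exists l : list Z, double_base_representation r l n.

(* A relation rather than a function; [is_span_total] and [is_span_unique]
   show that it is the graph of one. *)
Definition is_span (n : Z) (r : nat) : Prop :=
  has_representation n r /\
  forall s : nat, has_representation n s -> (r <= s)%nat.

(* [is_S i m] reads "S(i) exists and equals m". *)
Definition is_S (i : nat) (m : Z) : Prop :=
  0 < m /\ is_span m i /\
  forall k : Z, 0 < k -> is_span k i -> m <= k.

Lemma two_three_integer_1 : two_three_integer 1.
Proof.
  split; [lia |]. intros p Hp Hd. exfalso.
  apply prime_ge_2 in Hp. apply Z.divide_pos_le in Hd; lia.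
Qed.

Lemma two_three_integer_opp m :
  two_three_integer m -> two_three_integer (- m).
Proof.
  intros [H0 H]. split; [lia |]. intros p Hp Hd.
  apply H; [exact Hp |]. now apply (proj1 (Z.divide_opp_r p m)).
Qed.

Lemma two_three_integer_mul m n :
  two_three_integer m -> two_three_integer n -> two_three_integer (m * n).
Proof.
  intros [Hm0 Hm] [Hn0 Hn]. split; [nia |]. intros p Hp Hd.
  destruct (prime_mult p Hp m n Hd); auto.
Qed.

Lemma two_three_integer_2 : two_three_integer 2.
Proof.
  split; [lia |]. intros p Hp Hd. left.
  apply prime_ge_2 in Hp. apply Z.divide_pos_le in Hd; lia.
Qed.

Lemma two_three_integer_3 : two_three_integer 3.
Proof.
  split; [lia |]. intros p Hp Hd. right.
  exact (prime_div_prime p 3 Hp prime_3 Hd).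
Qed.

Lemma two_three_integer_pow m (a : nat) :
  two_three_integer m -> two_three_integer (m ^ Z.of_nat a).
Proof.
  intros H. induction a as [|a IH].
  - exact two_three_integer_1.
  - rewrite Nat2Z.inj_succ, Z.pow_succ_r by lia.
    now apply two_three_integer_mul.
Qed.

Lemma prime_divisor_exists (m : Z) : 1 < m -> exists p, prime p /\ (p | m).
Proof.
  intros Hm. assert (H0 : 0 <= m) by lia. revert Hm. pattern m.
  apply Zlt_0_ind; [| exact H0]. clear m H0. intros m IH _ Hm.
  destruct (prime_dec m) as [Hp | Hp].
  - exists m. split; [exact Hp | apply Z.divide_refl].
  - destruct (not_prime_divide m Hm Hp) as [k [Hk Hd]].
    destruct (IH k) as [p [Hpp Hpd]]; [lia | lia |].
    exists p. split; [exact Hpp | exact (Z.divide_trans _ _ _ Hpd Hd)].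
Qed.

Lemma two_three_integer_pos (m : Z) :
  0 < m -> two_three_integer m ->
  exists a b : nat, m = 2 ^ Z.of_nat a * 3 ^ Z.of_nat b.
Proof.
  intros Hm. assert (H0 : 0 <= m) by lia. revert Hm. pattern m.
  apply Zlt_0_ind; [| exact H0]. clear m H0. intros m IH _ Hm [_ H].
  destruct (Z.eq_dec m 1) as [-> | Hm1].
  { exists 0%nat, 0%nat. reflexivity. }
  destruct (prime_divisor_exists m) as [p [Hp [q Hq]]]; [lia |].
  assert (Hp2 := prime_ge_2 p Hp).
  assert (Hq0 : 0 < q) by nia.
  destruct (IH q) as [a [b Hab]]; [nia | exact Hq0 | |].
  { split; [lia |]. intros p' Hp' Hd. apply H; [exact Hp' |].
    rewrite Hq. now apply Z.divide_mul_l. }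
  destruct (H p Hp) as [-> | ->]; [now exists q | |].
  - exists (S a), b. rewrite Nat2Z.inj_succ, Z.pow_succ_r by lia.
    rewrite Hq, Hab. ring.
  - exists a, (S b). rewrite Nat2Z.inj_succ, Z.pow_succ_r by lia.
    rewrite Hq, Hab. ring.
Qed.

Lemma two_three_integer_iff (m : Z) :
  two_three_integer m <->
  exists a b : nat, m = 2 ^ Z.of_nat a * 3 ^ Z.of_nat b \/
                    m = - (2 ^ Z.of_nat a * 3 ^ Z.of_nat b).
Proof.
  split.
  - intros H. destruct (Z_lt_le_dec 0 m) as [Hm | Hm].
    + destruct (two_three_integer_pos m Hm H) as [a [b E]].
      exists a, b. now left.
    + assert (H0 := proj1 H).
      destruct (two_three_integer_pos (- m)) as [a [b E]];
        [lia | now apply two_three_integer_opp |].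
      exists a, b. right. lia.
  - assert (K : forall a b : nat,
      two_three_integer (2 ^ Z.of_nat a * 3 ^ Z.of_nat b)).
    { intros a b. apply two_three_integer_mul; apply two_three_integer_pow;
        [exact two_three_integer_2 | exact two_three_integer_3]. }
    intros [a [b [-> | ->]]]; [| apply two_three_integer_opp]; apply K.
Qed.

Lemma has_representation_exists (n : Z) : exists r, has_representation n r.
Proof.
  assert (K : forall e, two_three_integer e -> forall k : nat,
    has_representation (e * Z.of_nat k) k).
  { intros e He k. exists (repeat e k). repeat split.
    - apply repeat_length.
    - apply Forall_forall. intros x Hx. now rewrite (repeat_spec _ _ _ Hx).
    - induction k as [|k IH]; [simpl; lia |].
      rewrite Nat2Z.inj_succ. cbn [repeat fold_right]. lia. }
  exists (Z.to_nat (Z.abs n)). destruct (Z_le_gt_dec 0 n) as [Hn | Hn].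
  - replace n with (1 * Z.of_nat (Z.to_nat (Z.abs n))) at 1 by lia.
    apply K, two_three_integer_1.
  - replace n with (- 1 * Z.of_nat (Z.to_nat (Z.abs n))) at 1 by lia.
    apply K, (two_three_integer_opp 1), two_three_integer_1.
Qed.

Lemma is_span_total (n : Z) : exists r, is_span n r.
Proof.
  destruct (dec_inh_nat_subset_has_unique_least_element
    (has_representation n)) as [r [[Hr Hmin] _]].
  - intros r. apply classic.
  - apply has_representation_exists.
  - exists r. now split.
Qed.

Lemma is_span_unique (n : Z) (r s : nat) :
  is_span n r -> is_span n s -> r = s.
Proof.
  intros [Hr Hr'] [Hs Hs']. apply Nat.le_antisymm; auto.
Qed.

Lemma is_S_unique (i : nat) (m n : Z) : is_S i m -> is_S i n -> m = n.
Proof.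
  intros [Hm [Hm1 Hm2]] [Hn [Hn1 Hn2]]. apply Z.le_antisymm; auto.
Qed.

(* Main.v *)
(** An upper bound on the spans below N is obtained by descent.  If
    n - s = 2^i 3^j q for a {2,3}-integer s and q has span at most r, then n has
    span at most r + 1.  Every odd n is congruent to some +-3^b modulo 2^k, and
    every n prime to 3 to some +-2^a modulo 3^k.  Hence the n < N that
    are not reached from small q come, through n = s + 2^k q, from the few q < N / 2^k
    that are themselves exceptional, and most of these n are reached through
    another s.  In this way the sets of sums of two and three terms below 2^21
    settle span 4 up to 5330000, and span 4 up to 5330000 settles span 5.

    For the lower bounds, suppose n is a sum of r terms +-2^a 3^b.  Modulo
    2^4 3^3 5 7 13 73 the exponents a and b matter only modulo 36 and 12, apart
    from small values, which leaves 1200 classes of terms and an enumerable set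
    of r-tuples of classes with sum n (about 145000 for r = 5).  Each of them is
    refined by letting the periods of the exponents grow, and is tested modulo
    19 37, then 109, 433, 64, 17 97 and 577: the primes are chosen such that 2 and 3
    have small order, and the number of solutions decreases to zero. *)
Require Import Defs.
From Stdlib Require Import ZArith Znumtheory Zpow_facts List Bool Lia.
From Stdlib Require Import MSetPositive FMapPositive.
Import ListNotations.
Open Scope Z_scope.

(** * Representations *)

Lemma prime_divide_pow (p b n : Z) : prime p -> 0 <= n -> (p | b ^ n) -> (p | b).
Proof.
  intros Hp Hn. pattern n. apply natlike_ind; [| | exact Hn]; clear n Hn.
  - intros Hd. apply Z.divide_1_r_nonneg in Hd; apply prime_ge_2 in Hp; lia.
  - intros n Hn IH Hd. rewrite Z.pow_succ_r in Hd by exact Hn.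
    apply prime_mult in Hd as [Hd | Hd]; auto.
Qed.

(** Only a sufficient test: it accepts the divisors of 6^40, of either sign. All exponents of the
    terms tested below are less than 40. *)
Definition smooth (m : Z) : bool := negb (m =? 0) && (6 ^ 40 mod m =? 0).

Lemma smooth_spec (m : Z) : smooth m = true -> two_three_integer m.
Proof.
  unfold smooth. intros H. apply andb_true_iff in H as [H0 H].
  apply negb_true_iff, Z.eqb_neq in H0. apply Z.eqb_eq in H.
  split; [exact H0 |]. intros p Hp Hd.
  assert (K : (p | 2 * 3)).
  { apply prime_divide_pow with 40; [exact Hp | lia |].
    apply Z.divide_trans with m; [exact Hd |]. now apply Z.mod_divide. }
  apply prime_mult in K as [K | K]; [| | exact Hp].
  - left. now apply prime_div_prime; auto using prime_2.
  - right. now apply prime_div_prime; auto using prime_3.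
Qed.

Lemma two_three_integer_2_3 (i j : Z) : 0 <= i -> 0 <= j -> two_three_integer (2 ^ i * 3 ^ j).
Proof.
  intros Hi Hj. rewrite <- (Z2Nat.id i), <- (Z2Nat.id j) by assumption.
  apply two_three_integer_mul; apply two_three_integer_pow;
    [apply two_three_integer_2 | apply two_three_integer_3].
Qed.

Lemma representation_cons (x n : Z) (r : nat) :
  two_three_integer x -> has_representation n r -> has_representation (x + n) (S r).
Proof.
  intros Hx [l [Hl [H E]]]. exists (x :: l). repeat split; simpl; [lia | auto | lia].
Qed.

Lemma representation_mul (m n : Z) (r : nat) :
  two_three_integer m -> has_representation n r -> has_representation (m * n) r.
Proof.
  intros Hm [l [Hl [H E]]]. exists (map (Z.mul m) l). repeat split.
  - now rewrite length_map.
  - rewrite Forall_map. apply Forall_impl with (2 := H). intros x. now apply two_three_integer_mul.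
  - rewrite <- E. clear. induction l as [|x l IH]; simpl; lia.
Qed.

Lemma representation_opp (n : Z) (r : nat) :
  has_representation n r -> has_representation (- n) r.
Proof.
  intros H. replace (- n) with (- 1 * n) by lia.
  apply representation_mul; [| exact H].
  apply (two_three_integer_opp 1), two_three_integer_1.
Qed.

(* x = 2 x - x lengthens a representation by one. *)
Lemma representation_le (n : Z) (r s : nat) :
  (0 < r <= s)%nat -> has_representation n r -> has_representation n s.
Proof.
  intros [Hr Hs] H. induction Hs as [|s Hs [l [Hl [K E]]]]; [exact H |].
  destruct l as [|x l]; [simpl in Hl; lia |]. inversion_clear K.
  exists (x * 2 :: - x :: l). repeat split; simpl in *; [lia | | lia].
  constructor; [| constructor]; auto using two_three_integer_opp.
  apply two_three_integer_mul; auto using two_three_integer_2.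
Qed.

Lemma representation_zero (r : nat) : has_representation 0 (S (S r)).
Proof.
  apply representation_le with 2%nat; [lia |]. exists [1; -1].
  split; [reflexivity | split; [| reflexivity]]. constructor; [apply two_three_integer_1 |].
  constructor; [| constructor]. apply (two_three_integer_opp 1), two_three_integer_1.
Qed.

Lemma is_S_intro (r : nat) (m : Z) :
  (0 < r)%nat -> 1 < m -> ~ has_representation m r ->
  (forall k, 0 < k < m -> has_representation k r) -> is_S (S r) m.
Proof.
  intros Hr Hm Hn H. split; [lia |]. split; [split |].
  - replace m with (1 + (m - 1)) by lia.
    apply representation_cons; [apply two_three_integer_1 | apply H; lia].
  (* A representation of length at most r could be lengthened to r, unless it is empty, and then m
     would be 0. *)
  - intros s Hs. destruct (Nat.le_gt_cases (S r) s) as [K | K]; [exact K |].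
    exfalso. apply Hn. destruct s as [|s].
    + destruct Hs as [l [Hl [_ E]]]. destruct l; [simpl in E; lia | discriminate].
    + apply representation_le with (S s); [lia | exact Hs].
  - intros k Hk [_ K]. destruct (Z_lt_le_dec k m) as [L | L]; [| exact L].
    specialize (K r (H k (conj Hk L))). lia.
Qed.

Lemma two_three_part (k : Z) : 0 < k ->
  exists i j p, 0 <= i /\ 0 <= j /\ 0 < p <= k /\ k = 2 ^ i * (3 ^ j * p) /\
    p mod 2 <> 0 /\ p mod 3 <> 0.
Proof.
  intros Hk. assert (H0 : 0 <= k) by lia. revert Hk. pattern k.
  apply Zlt_0_ind; [| exact H0]. clear k H0. intros k IH _ Hk.
  destruct (Z.eq_dec (k mod 2) 0) as [E | E]; [| destruct (Z.eq_dec (k mod 3) 0) as [F | F]].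
  - apply Z_div_exact_full_2 in E; [| lia].
    destruct (IH (k / 2)) as (i & j & p & Hi & Hj & Hp & Ek & H); [lia | lia |].
    exists (Z.succ i), j, p. rewrite Z.pow_succ_r by exact Hi.
    repeat split; try apply H; lia.
  - apply Z_div_exact_full_2 in F; [| lia].
    destruct (IH (k / 3)) as (i & j & p & Hi & Hj & Hp & Ek & H); [lia | lia |].
    exists i, (Z.succ j), p. rewrite Z.pow_succ_r by exact Hj.
    repeat split; try apply H; lia.
  - exists 0, 0, k. repeat split; auto; lia.
Qed.

Lemma representation_of_coprime (r : nat) (N : Z) :
  (forall p, 0 < p < N -> p mod 2 <> 0 -> p mod 3 <> 0 -> has_representation p r) ->
  forall k, 0 < k < N -> has_representation k r.
Proof.
  intros H k [Hk L]. destruct (two_three_part k Hk) as (i & j & p & Hi & Hj & Hp & E & H2 & H3).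
  rewrite E, Z.mul_assoc. apply representation_mul; [now apply two_three_integer_2_3 |].
  apply H; auto. lia.
Qed.

(** * Folds and tables of function values *)

Lemma fold_left_invariant {A B} (P : A -> Prop) (f : A -> B -> A) (l : list B) (a : A) :
  P a -> (forall a b, In b l -> P a -> P (f a b)) -> P (fold_left f l a).
Proof.
  revert a. induction l as [|b l IH]; simpl; intros a Ha H; [exact Ha |].
  apply IH; auto.
Qed.

(** Keys are read low bit first: below a path with value r and weight w, the key x stands for r + w
    x. Depth n covers the arguments from 1 to 2^n - 1, and [recall] evaluates f at all others. *)
Fixpoint memoize {A} (n : nat) (f : Z -> A) (r w : Z) : PositiveMap.t A :=
  match n with
  | O => PositiveMap.Leaf A
  | S n => PositiveMap.Node (memoize n f r (2 * w)) (Some (f (r + w))) (memoize n f (r + w) (2 * w))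
  end.

Definition recall {A} (f : Z -> A) (t : PositiveMap.t A) (z : Z) : A :=
  match z with
  | Zpos x => match PositiveMap.find x t with Some v => v | None => f z end
  | _ => f z
  end.

(* The table is computed once for all calls of [tabulate n f]. *)
Definition tabulate {A} (n : nat) (f : Z -> A) : Z -> A :=
  let t := memoize n f 0 1 in recall f t.

Lemma find_memoize {A} (n : nat) (f : Z -> A) (r w : Z) (x : positive) (v : A) :
  PositiveMap.find x (memoize n f r w) = Some v -> v = f (r + w * Zpos x).
Proof.
  revert r w x. induction n as [|n IH]; intros r w x; [destruct x; discriminate |].
  destruct x; cbn [memoize PositiveMap.find]; intros H.
  - apply IH in H. rewrite H, (Pos2Z.inj_xI x). apply (f_equal f). ring.
  - apply IH in H. rewrite H, (Pos2Z.inj_xO x). apply (f_equal f). ring.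
  - injection H as <-. apply (f_equal f). ring.
Qed.

Lemma tabulate_eq {A} (n : nat) (f : Z -> A) (z : Z) : tabulate n f z = f z.
Proof.
  unfold tabulate, recall. destruct z as [|x|x]; try reflexivity.
  destruct (PositiveMap.find x _) eqn:E; [| reflexivity].
  now apply find_memoize in E.
Qed.

(** * Integers of span 2 and 3 *)

Fixpoint powers (n : nat) (b x : Z) : list Z :=
  match n with O => [] | S n => x :: powers n b (b * x) end.

Lemma two_three_integer_powers (n : nat) (b x y : Z) :
  two_three_integer b -> two_three_integer x -> In y (powers n b x) -> two_three_integer y.
Proof.
  intros Hb. revert x. induction n as [|n IH]; simpl; intros x Hx H; [tauto |].
  destruct H as [<- | H]; [exact Hx |]. apply IH in H; auto using two_three_integer_mul.
Qed.

Definition signs (l : list Z) : list Z := flat_map (fun x => [x; - x]) l.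

Lemma in_signs (l : list Z) (x : Z) :
  (forall y, In y l -> two_three_integer y) -> In x (signs l) -> two_three_integer x.
Proof.
  intros Hl H. apply in_flat_map in H as [y [Hy [<- | [<- | []]]]];
    auto using two_three_integer_opp.
Qed.

Fixpoint odd_part (p : positive) : positive :=
  match p with xO p => odd_part p | _ => p end.

(** Representability is preserved by a change of sign and by doubling, so a lookup of the odd part
    suffices. *)
Definition covers (t : PositiveSet.t) (z : Z) : bool :=
  match z with
  | Z0 => true
  | Zpos p | Zneg p => PositiveSet.mem (odd_part p) t
  end.

Definition represents (r : nat) (t : PositiveSet.t) : Prop :=
  forall p, PositiveSet.mem p t = true -> has_representation (Zpos p) r.

Lemma representation_odd_part (p : positive) (r : nat) :
  has_representation (Zpos (odd_part p)) r -> has_representation (Zpos p) r.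
Proof.
  induction p as [p _ | p IH |]; simpl; auto. intros H.
  change (Zpos (xO p)) with (2 * Zpos p).
  apply representation_mul; auto using two_three_integer_2.
Qed.

Lemma covers_sound (r : nat) (t : PositiveSet.t) (z : Z) :
  represents (S (S r)) t -> covers t z = true -> has_representation z (S (S r)).
Proof.
  intros Ht. destruct z as [|p|p]; simpl; intros H.
  - apply representation_zero.
  - now apply representation_odd_part, Ht.
  - now apply (representation_opp (Zpos p)), representation_odd_part, Ht.
Qed.

Lemma mem_add (p q : positive) (t : PositiveSet.t) :
  PositiveSet.mem p (PositiveSet.add q t) = true <-> p = q \/ PositiveSet.mem p t = true.
Proof. apply PositiveSet.add_spec. Qed.

Lemma represents_Leaf (r : nat) : represents r PositiveSet.Leaf.
Proof. intros p H. discriminate. Qed.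

Definition insert (B x : Z) (t : PositiveSet.t) : PositiveSet.t :=
  match x with
  | Zpos p => if x <? B then PositiveSet.add p t else t
  | _ => t
  end.

Lemma represents_insert (r : nat) (B x : Z) (t : PositiveSet.t) :
  has_representation x r -> represents r t -> represents r (insert B x t).
Proof.
  intros Hx Ht. unfold insert. destruct x; auto. destruct (_ <? _); auto.
  intros q H. apply mem_add in H as [-> | H]; auto.
Qed.

(** For the bound 4000000 used below the exponents are exhausted, since 2^22 and 3^14 exceed it. It
    is larger than 2^21 so that small differences of larger terms are found too. *)
Definition smooth_up_to (B : Z) : list Z :=
  filter (fun y => if y <? B then smooth y else false) (flat_map (powers 14 3) (powers 22 2 1)).

Lemma smooth_up_to_spec (B x : Z) : In x (smooth_up_to B) -> two_three_integer x.
Proof.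
  unfold smooth_up_to. rewrite filter_In. intros [_ H].
  destruct (x <? B); [now apply smooth_spec | discriminate].
Qed.

Definition pair_sums (B : Z) (l : list Z) : PositiveSet.t :=
  fold_left (fun t x => fold_left (fun t y => insert B (x - y) (insert B (x + y) t)) l t) l
    PositiveSet.Leaf.

Lemma represents_pair_sums (B : Z) (l : list Z) :
  (forall x, In x l -> two_three_integer x) -> represents 2 (pair_sums B l).
Proof.
  intros Hl.
  assert (K : forall x y, two_three_integer x -> two_three_integer y -> has_representation (x + y) 2).
  { intros x y Hx Hy. exists [x; y].
    split; [reflexivity | split; [auto | simpl; lia]]. }
  unfold pair_sums. apply fold_left_invariant; [apply represents_Leaf |].
  intros t x Hx Ht. apply fold_left_invariant; [exact Ht |].
  intros u y Hy Hu. apply represents_insert; [| apply represents_insert; [| exact Hu]].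
  - apply (K x (- y)); auto using two_three_integer_opp.
  - apply K; auto.
Qed.

Lemma mem_node (p : positive) (l r : PositiveSet.t) (b : bool) :
  PositiveSet.mem p (PositiveSet.node l b r) =
  match p with xH => b | xO p => PositiveSet.mem p l | xI p => PositiveSet.mem p r end.
Proof. rewrite PositiveSet.mem_node. now destruct p. Qed.

(** Tests whether 0 lies in c + e t. A set of positives cannot hold 0, but 0 is what remains when
    the bit of the result 1 is split off. *)
Definition vanishes (e c : Z) (t : PositiveSet.t) : bool :=
  match - (e * c) with Zpos p => PositiveSet.mem p t | _ => false end.

Lemma vanishes_spec (e c : Z) (t : PositiveSet.t) :
  e * e = 1 -> vanishes e c t = true ->
  exists q, PositiveSet.mem q t = true /\ c + e * Zpos q = 0.
Proof.
  unfold vanishes. intros He H. destruct (- (e * c)) as [|q|q] eqn:E; try discriminate.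
  exists q. split; [exact H |]. rewrite <- E. nia.
Qed.

(* [s] together with positive elements of c + e t, for e = 1 or -1; the low bits of
   the results are read off those of [c], which is halved at each exceptions. *)
Fixpoint affine_union (e : Z) (t s : PositiveSet.t) (c : Z) : PositiveSet.t :=
  match t with
  | PositiveSet.Leaf => s
  | PositiveSet.Node l b r =>
    if (e =? 1) && (c =? 0) then PositiveSet.union s t
    else if (e =? -1) && (c <=? 1) then s else
    let s := if b then match c + e with Zpos p => PositiveSet.add p s | _ => s end else s in
    let '(l', b', r') := match s with
      | PositiveSet.Leaf => (PositiveSet.Leaf, false, PositiveSet.Leaf)
      | PositiveSet.Node l b r => (l, b, r) end in
    let c0 := Z.div2 c in
    let c1 := Z.div2 (c + e) in
    if Z.even c
    then PositiveSet.node (affine_union e l l' c0) (b' || vanishes e c1 r) (affine_union e r r' c1)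
    else PositiveSet.node (affine_union e r l' c1) (b' || vanishes e c0 l) (affine_union e l r' c0)
  end.

Lemma mem_affine_union (e : Z) (t s : PositiveSet.t) (c : Z) (p : positive) :
  e * e = 1 -> PositiveSet.mem p (affine_union e t s c) = true ->
  PositiveSet.mem p s = true \/
  exists q, PositiveSet.mem q t = true /\ Zpos p = c + e * Zpos q.
Proof.
  intros He. revert s c p. induction t as [|l IHl b r IHr]; intros s c p; [now left |].
  cbn [affine_union].
  destruct ((e =? 1) && (c =? 0)) eqn:E1.
  { apply andb_true_iff in E1 as [E1 E2]. apply Z.eqb_eq in E1, E2. subst e c.
    intros H. apply PositiveSet.union_spec in H as [H | H]; [now left |].
    right. exists p. split; [exact H | lia]. }
  destruct ((e =? -1) && (c <=? 1)); [now left |]. clear E1.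
  set (s' := if b then _ else s).
  assert (Hs' : forall q, PositiveSet.mem q s' = true -> PositiveSet.mem q s = true \/
    b = true /\ Zpos q = c + e).
  { intros q. unfold s'. destruct b; [| now left].
    destruct (c + e) eqn:E; try (now left). intros H. apply mem_add in H as [-> | H]; auto. }
  clearbody s'.
  set (u := match s' with PositiveSet.Leaf => _ | PositiveSet.Node l b r => _ end).
  assert (Hu : let '(l', b', r') := u in forall q, PositiveSet.mem q s' =
    match q with xH => b' | xO q => PositiveSet.mem q l' | xI q => PositiveSet.mem q r' end).
  { unfold u. destruct s'; intros [q|q|]; reflexivity. }
  clearbody u. destruct u as [[l' b'] r'].
  assert (K : PositiveSet.mem p s' = true -> PositiveSet.mem p s = true \/
    exists q, PositiveSet.mem q (PositiveSet.Node l b r) = true /\ Zpos p = c + e * Zpos q).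
  { intros H. apply Hs' in H as [H | [Hb H]]; [now left | right].
    exists xH. split; [exact Hb | lia]. }
  (* As e is odd, c and c + e have opposite parities, and the last bit of q decides that of c + e
     q. *)
  assert (Hodd : Z.odd c = negb (Z.even c)) by (symmetry; apply Z.negb_even).
  assert (Hodd' : Z.odd (c + e) = Z.even c).
  { rewrite Z.odd_add, Hodd. replace (Z.odd e) with true; [now destruct (Z.even c) |].
    assert (De : e = 1 \/ e = -1) by nia. now destruct De as [-> | ->]. }
  assert (E0 := Z.div2_odd c). assert (E1 := Z.div2_odd (c + e)).
  rewrite Hodd in E0. rewrite Hodd' in E1. clear Hodd Hodd'.
  assert (L : forall q, PositiveSet.mem q l = true ->
    PositiveSet.mem (xO q) (PositiveSet.Node l b r) = true /\ c + e * Zpos (xO q) =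
      2 * (Z.div2 c + e * Zpos q) + Z.b2z (negb (Z.even c))).
  { intros q Hq. split; [exact Hq |]. rewrite (Pos2Z.inj_xO q). lia. }
  assert (R : forall q, PositiveSet.mem q r = true ->
    PositiveSet.mem (xI q) (PositiveSet.Node l b r) = true /\ c + e * Zpos (xI q) =
      2 * (Z.div2 (c + e) + e * Zpos q) + Z.b2z (Z.even c)).
  { intros q Hq. split; [exact Hq |]. rewrite (Pos2Z.inj_xI q). lia. }
  clear E0 E1 Hs'.
  destruct (Z.even c); rewrite mem_node; cbn [negb Z.b2z] in L, R.
  - destruct p as [p|p|]; intros H.
    + apply IHr in H as [H | [q [Hq E]]]; [apply K; now rewrite Hu |].
      right. exists (xI q). destruct (R q Hq). split; [assumption | lia].
    + apply IHl in H as [H | [q [Hq E]]]; [apply K; now rewrite Hu |].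
      right. exists (xO q). destruct (L q Hq). split; [assumption | lia].
    + apply orb_true_iff in H as [H | H]; [apply K; now rewrite Hu |].
      apply vanishes_spec in H as [q [Hq E]]; [| exact He].
      right. exists (xI q). destruct (R q Hq). split; [assumption | lia].
  - destruct p as [p|p|]; intros H.
    + apply IHl in H as [H | [q [Hq E]]]; [apply K; now rewrite Hu |].
      right. exists (xO q). destruct (L q Hq). split; [assumption | lia].
    + apply IHr in H as [H | [q [Hq E]]]; [apply K; now rewrite Hu |].
      right. exists (xI q). destruct (R q Hq). split; [assumption | lia].
    + apply orb_true_iff in H as [H | H]; [apply K; now rewrite Hu |].
      apply vanishes_spec in H as [q [Hq E]]; [| exact He].
      right. exists (xO q). destruct (L q Hq). split; [assumption | lia].
Qed.

(* A representation of an odd integer has an odd term +-3^b, and the sum of the other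
   terms is even: hence the translates of 2 s. *)
Definition add_odd_terms (l : list Z) (s : PositiveSet.t) : PositiveSet.t :=
  let t := PositiveSet.Node s false PositiveSet.Leaf in
  fold_left (fun u x => affine_union 1 t (affine_union (-1) t (affine_union 1 t u (- x)) x) x) l
    PositiveSet.Leaf.

Lemma represents_add_odd_terms (r : nat) (l : list Z) (s : PositiveSet.t) :
  (forall x, In x l -> two_three_integer x) -> represents r s ->
  represents (S r) (add_odd_terms l s).
Proof.
  intros Hl Hs. unfold add_odd_terms. apply fold_left_invariant; [apply represents_Leaf |].
  assert (Ht : forall q, PositiveSet.mem q (PositiveSet.Node s false PositiveSet.Leaf) = true ->
    has_representation (Zpos q) r).
  { intros [q|q|] H; try discriminate. change (Zpos (xO q)) with (2 * Zpos q).
    apply representation_mul; auto using two_three_integer_2. }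
  revert Ht. generalize (PositiveSet.Node s false PositiveSet.Leaf). intros t Ht.
  assert (K : forall e u x, e = 1 \/ e = -1 -> two_three_integer x -> represents (S r) u ->
    represents (S r) (affine_union e t u x)).
  { intros e u x He Hx Hu p H. apply mem_affine_union in H as [H | [q [Hq E]]]; [auto | | lia].
    rewrite E. apply representation_cons; [exact Hx |]. apply Ht in Hq.
    destruct He as [-> | ->].
    - now rewrite Z.mul_1_l.
    - replace (-1 * Zpos q) with (- Zpos q) by lia. now apply representation_opp. }
  intros u x Hx Hu. apply Hl in Hx.
  apply K; [auto | exact Hx |]. apply K; [auto | exact Hx |].
  apply K; auto using two_three_integer_opp.
Qed.

(** The range is traversed by a binary iteration with a counter, and never exists as a list or a
    unary number. *)
Definition missing (good : Z -> bool) (B : positive) : list Z :=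
  snd (Pos.iter (fun c : Z * list Z =>
    let (q, l) := c in (q + 1, if good q then l else q :: l)) (0, []) B).

Lemma missing_spec (good : Z -> bool) (B : positive) (q : Z) :
  0 <= q < Zpos B -> In q (missing good B) \/ good q = true.
Proof.
  unfold missing. revert q.
  set (f := fun c : Z * list Z => _).
  enough (K : fst (Pos.iter f (0, []) B) = Zpos B /\ forall q,
    0 <= q < fst (Pos.iter f (0, []) B) -> In q (snd (Pos.iter f (0, []) B)) \/ good q = true).
  { destruct K as [K K']. rewrite K in K'. exact K'. }
  pattern B. apply Pos.peano_ind.
  - simpl. split; [reflexivity |]. intros q Hq. replace q with 0 by lia.
    destruct (good 0); simpl; auto.
  - intros p [IH1 IH2]. rewrite Pos.iter_succ.
    destruct (Pos.iter f (0, []) p) as [q0 l]. simpl in *. subst q0.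
    split; [lia |]. intros q Hq.
    destruct (Z.eq_dec q (Zpos p)) as [-> | N].
    + destruct (good (Zpos p)); simpl; auto.
    + destruct (IH2 q) as [H | H]; [lia | | auto]. left. destruct (good (Zpos p)); simpl; auto.
Qed.

(** * Descent *)

(* An entry (m, m', l) proposes the terms s, listed in l as (s mod m, s), for those n with
   m | n - s but not m' | n - s; for m' = 0 the second condition is void unless n = s. *)
Definition config := list (Z * Z * list (Z * Z)).

(** The filters discard nothing from the lists used below; they reduce [valid] to the divisibility
    of K by the moduli. *)
Definition configure (l : list (Z * Z * list Z)) : config :=
  map (fun c => let '(m, m', s) := c in
    (m, m', map (fun s => (s mod m, s)) (filter smooth (signs s))))
    (filter (fun c => smooth (fst (fst c))) l).

Definition valid (K : Z) (cfg : config) : Prop :=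
  forall m m' l, In (m, m', l) cfg -> two_three_integer m /\ (m | K) /\
    forall c, In c l -> two_three_integer (snd c).

Lemma valid_configure (K : Z) (l : list (Z * Z * list Z)) :
  forallb (fun c => K mod fst (fst c) =? 0) l = true -> valid K (configure l).
Proof.
  intros H m m' s Hs. unfold configure in Hs.
  apply in_map_iff in Hs as [[[n n'] u] [E Hs]]. injection E as -> -> <-.
  apply filter_In in Hs as [Hs Hm]. apply smooth_spec in Hm. simpl in Hm.
  split; [exact Hm | split].
  - rewrite forallb_forall in H. specialize (H _ Hs). simpl in H. apply Z.eqb_eq in H.
    apply Z.mod_divide; [exact (proj1 Hm) | exact H].
  - intros c Hc. apply in_map_iff in Hc as [x [<- Hx]].
    apply filter_In in Hx as [_ Hx]. now apply smooth_spec.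
Qed.

Lemma valid_app (K : Z) (c d : config) : valid K c -> valid K d -> valid K (c ++ d).
Proof. intros Hc Hd m m' l H. apply in_app_iff in H as [H | H]; [eapply Hc | eapply Hd]; exact H. Qed.

(** The stored residue only preselects s; divisibility is tested again, so soundness does not rest
    on it. If m' divides n - s, the quotient by m is m' / m times the quotient by m', which is left
    to the terms at m'. *)
Definition tests (cfg : config) (n : Z) : list (list Z) :=
  map (fun c => let '(m, m', l) := c in
    let r := n mod m in
    flat_map (fun c : Z * Z => if fst c =? r then
      let d := n - snd c in
      if d mod m =? 0 then if d mod m' =? 0 then [] else [d / m] else [] else []) l) cfg.

Definition strides (K : Z) (cfg : config) : list Z := map (fun c => K / fst (fst c)) cfg.

(* [tests] and [strides] depend on n modulo K only up to translation: if x = n - K w, then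
   (n - s) / m = (x - s) / m + (K / m) w. *)
Fixpoint hit (good : Z -> bool) (tss : list (list Z)) (ws : list Z) : bool :=
  match tss, ws with
  | ts :: tss, w :: ws => if existsb (fun t => good (t + w)) ts then true else hit good tss ws
  | _, _ => false
  end.

Lemma hit_sound (r : nat) (good : Z -> bool) (K x w : Z) (cfg : config) :
  (forall z, good z = true -> has_representation z r) -> valid K cfg ->
  hit good (tests cfg x) (map (fun k => k * w) (strides K cfg)) = true ->
  has_representation (x + K * w) (S r).
Proof.
  intros Hg. induction cfg as [|[[m m'] l] cfg IH]; simpl; intros Hv H; [discriminate |].
  destruct (existsb _ _) eqn:E.
  - apply existsb_exists in E as [t [Ht Hgt]]. apply in_flat_map in Ht as [[u s] [Hs Ht]].
    simpl in Ht. destruct (u =? x mod m); [| easy].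
    destruct (Hv m m' l) as [Hm [Hd Hl]]; [now left |]. specialize (Hl _ Hs). simpl in Hl.
    destruct ((x - s) mod m =? 0) eqn:E1; [| easy].
    destruct ((x - s) mod m' =? 0); [easy |]. destruct Ht as [<- | []].
    apply Z.eqb_eq in E1.
    assert (F1 := Z_div_exact_full_2 (x - s) m (proj1 Hm) E1).
    destruct Hd as [k ->]. rewrite Z.div_mul in Hgt by exact (proj1 Hm).
    replace (x + k * m * w) with (s + m * ((x - s) / m + k * w)) by nia.
    apply representation_cons; [exact Hl |]. apply representation_mul; [exact Hm | auto].
  - apply IH; [| exact H]. intros n n' l' Hn. apply (Hv n n' l'). now right.
Qed.

(* Candidates n = c + M q with q in E, written as n = c + M r + M D w with q = D w + r;
   those n < N for which no test succeeds are returned. *)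
Definition exceptions (M D : Z) (cs : list Z) (cfg : config) (good : Z -> bool) (N : Z)
    (E : list Z) : list Z :=
  let row := tabulate 7 (fun r => flat_map (fun c =>
    let x := c + M * r in
    if (x mod 2 =? 0) || (x mod 3 =? 0) then [] else [(c, tests cfg x)]) cs) in
  let ks := strides (M * D) cfg in
  flat_map (fun q =>
    let (w, r) := Z.div_eucl q D in
    let ws := map (fun k => k * w) ks in
    flat_map (fun e : Z * list (list Z) =>
      if hit good (snd e) ws then [] else
      let n := fst e + M * q in
      if (0 <? n) && (n <? N) then [n] else []) (row r)) E.

(** An odd n is c + M q for some c in cs, so a representation of q gives one of n with one more
    term. Otherwise q lies in E, and n is either reached by a test or returned. *)
Lemma exceptions_spec (r : nat) (M D : Z) (cs : list Z) (cfg : config) (good : Z -> bool)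
    (N B lo : Z) (E : list Z) (n : Z) :
  (forall z, good z = true -> has_representation z r) -> valid (M * D) cfg ->
  two_three_integer M -> 0 < M -> 0 < D -> (6 | M * D) ->
  (forall c, In c cs -> two_three_integer c /\ N - c <= M * B /\ c <= M * lo) -> lo <= B ->
  (forall n, n mod 2 <> 0 -> exists c, In c cs /\ (n - c) mod M = 0) ->
  (forall q, 0 <= q < B -> In q E \/ has_representation q r) ->
  forallb (Z.leb lo) E = true ->
  0 < n < N -> n mod 2 <> 0 -> n mod 3 <> 0 ->
  In n (exceptions M D cs cfg good N E) \/ has_representation n (S r).
Proof.
  intros Hg Hv HM M0 D0 [k6 H6] Hcs Hlo Hres HE Hmin Hn n2 n3.
  destruct (Hres n n2) as [c [Hc E1]]. destruct (Hcs c Hc) as [Tc [Bc Lc]].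
  apply Z_div_exact_full_2 in E1; [| lia]. set (q := (n - c) / M) in *.
  assert (En : n = c + M * q) by lia.
  assert (K : has_representation q r -> has_representation n (S r)).
  { intros H. rewrite En. apply representation_cons, representation_mul; auto. }
  destruct (Z_lt_le_dec q 0) as [Hq | Hq].
  (* Here 0 < - q < lo because n > 0 and c <= M lo, and no member of E is below lo. *)
  - right. apply K. replace q with (- - q) by lia. apply representation_opp.
    destruct (HE (- q)) as [H | H]; [nia | | exact H].
    rewrite forallb_forall in Hmin. apply Hmin, Z.leb_le in H. nia.
  - destruct (HE q) as [H | H]; [nia | | right; auto].
    unfold exceptions. destruct (Z.div_eucl q D) as [w d] eqn:Ew.
    assert (Hw := Z_div_mod q D (Z.lt_gt _ _ D0)). rewrite Ew in Hw. destruct Hw as [Ewd Hd].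
    assert (En' : n = c + M * d + M * D * w) by (rewrite En, Ewd; ring).
    destruct (hit good (tests cfg (c + M * d)) (map (fun k => k * w) (strides (M * D) cfg))) eqn:Eh.
    + right. rewrite En'. now apply hit_sound with good cfg.
    + left. apply in_flat_map. exists q. split; [exact H |]. rewrite Ew.
      apply in_flat_map. exists (c, tests cfg (c + M * d)). rewrite tabulate_eq. split.
      * apply in_flat_map. exists c. split; [exact Hc |].
        (* Since 6 divides M D, the residues of n modulo 2 and 3 can be read off c + M d. *)
        replace ((c + M * d) mod 2) with (n mod 2);
          [| rewrite En', H6; replace (k6 * 6 * w) with (k6 * 3 * w * 2) by ring; apply Z_mod_plus_full].
        replace ((c + M * d) mod 3) with (n mod 3);
          [| rewrite En', H6; replace (k6 * 6 * w) with (k6 * 2 * w * 3) by ring; apply Z_mod_plus_full].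
        apply Z.eqb_neq in n2, n3. rewrite n2, n3. now left.
      * simpl. rewrite Eh, <- En.
        replace (0 <? n) with true by (symmetry; apply Z.ltb_lt; lia).
        replace (n <? N) with true by (symmetry; apply Z.ltb_lt; lia). now left.
Qed.

Lemma odd_residues (M : Z) (cs : list Z) (n : Z) : 0 < M -> M mod 2 = 0 ->
  forallb (fun x => if x mod 2 =? 0 then true else existsb (fun c => (x - c) mod M =? 0) cs)
    (map Z.of_nat (seq 0 (Z.to_nat M))) = true ->
  n mod 2 <> 0 -> exists c, In c cs /\ (n - c) mod M = 0.
Proof.
  intros HM H2 H Hn. rewrite forallb_forall in H.
  assert (Hb := Z.mod_pos_bound n M HM).
  specialize (H (n mod M)). destruct (Z.eqb_spec ((n mod M) mod 2) 0) as [E | _].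
  - exfalso. apply Hn. rewrite <- E. apply Z.mod_divide in H2; [| lia].
    apply Zmod_div_mod; [lia | lia | exact H2].
  - destruct (proj1 (existsb_exists _ _) (H ltac:(apply in_map_iff; exists (Z.to_nat (n mod M));
      rewrite in_seq; lia))) as [c [Hc E]].
    exists c. split; [exact Hc |]. apply Z.eqb_eq in E.
    now rewrite Zminus_mod_idemp_l in E.
Qed.

Fixpoint multiples_below (n : nat) (b N x : Z) : list Z :=
  match n with
  | O => []
  | S n => if x <? N then x :: multiples_below n b N (b * x) else []
  end.

Lemma in_multiples_below (n i : nat) (b N x : Z) :
  1 < b -> 0 < x -> b ^ Z.of_nat i * x < N -> (i < n)%nat ->
  In (b ^ Z.of_nat i * x) (multiples_below n b N x).
Proof.
  intros Hb. revert i x. induction n as [|n IH]; intros i x Hx Hi Hn; [lia |].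
  cbn [multiples_below].
  assert (Hp : 0 < b ^ Z.of_nat i) by (apply Z.pow_pos_nonneg; lia).
  destruct (Z.ltb_spec x N) as [L | L]; [| nia].
  destruct i as [|i]; [left; rewrite Z.pow_0_r; lia | right].
  rewrite Nat2Z.inj_succ, Z.pow_succ_r in * by lia.
  replace (b * b ^ Z.of_nat i * x) with (b ^ Z.of_nat i * (b * x)) in * by ring.
  apply IH; [nia | exact Hi | lia].
Qed.

(** The descent finds exceptions prime to 6, but the next descent divides down to arbitrary q, so
    all their multiples by 2^i 3^j must count as exceptional. Exponents below 23 suffice for N <=
    2^23. *)
Definition smooth_multiples (N : Z) (l : list Z) : list Z :=
  flat_map (fun x => flat_map (multiples_below 23 3 N) (multiples_below 23 2 N x)) l.

Lemma in_smooth_multiples (N : Z) (l : list Z) (i j x : Z) :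
  0 <= i -> 0 <= j -> 0 < x -> In x l -> N <= 2 ^ 23 -> 2 ^ i * (3 ^ j * x) < N ->
  In (2 ^ i * (3 ^ j * x)) (smooth_multiples N l).
Proof.
  intros Hi Hj Hx Hl HN H.
  assert (Pi : 0 < 2 ^ i) by (apply Z.pow_pos_nonneg; lia).
  assert (Pj : 0 < 3 ^ j) by (apply Z.pow_pos_nonneg; lia).
  assert (Li : i < 23) by (apply (Z.pow_lt_mono_r_iff 2); nia).
  assert (Lj : j < 23).
  { apply (Z.pow_lt_mono_r_iff 3); [lia | lia |]. apply Z.lt_trans with (2 ^ 23); [nia | reflexivity]. }
  unfold smooth_multiples. apply in_flat_map. exists x. split; [exact Hl |].
  apply in_flat_map. exists (2 ^ i * x).
  replace (2 ^ i * (3 ^ j * x)) with (3 ^ j * (2 ^ i * x)) in * by ring.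
  rewrite <- (Z2Nat.id i), <- (Z2Nat.id j) in * by assumption.
  split; apply in_multiples_below; try lia; nia.
Qed.

Definition set_of (l : list Z) : PositiveSet.t :=
  fold_left (fun t q => PositiveSet.add (Z.to_pos q) t) l PositiveSet.Leaf.

Lemma mem_set_of (l : list Z) (q : Z) :
  In q l -> PositiveSet.mem (Z.to_pos q) (set_of l) = true.
Proof.
  intros H. unfold set_of.
  enough (K : forall t, In q l \/ PositiveSet.mem (Z.to_pos q) t = true ->
    PositiveSet.mem (Z.to_pos q) (fold_left (fun t q => PositiveSet.add (Z.to_pos q) t) l t) = true)
    by auto.
  clear H. induction l as [|x l IH]; intros t H; simpl; [now destruct H |].
  apply IH. rewrite mem_add. destruct H as [[-> | H] | H]; auto.
Qed.

Definition good_below (B : Z) (bad : PositiveSet.t) (otherwise : Z -> bool) (z : Z) : bool :=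
  match z with
  | Z0 => true
  | Zpos p | Zneg p =>
    let p := odd_part p in
    if Zpos p <? B then negb (PositiveSet.mem p bad) else otherwise (Zpos p)
  end.

Lemma good_below_sound (r : nat) (B : Z) (E : list Z) (otherwise : Z -> bool) (z : Z) :
  (forall q, 0 <= q < B -> In q E \/ has_representation q (S (S r))) ->
  (forall z, otherwise z = true -> has_representation z (S (S r))) ->
  good_below B (set_of E) otherwise z = true -> has_representation z (S (S r)).
Proof.
  intros HE Ho.
  assert (K : forall p, (if Zpos (odd_part p) <? B
    then negb (PositiveSet.mem (odd_part p) (set_of E)) else otherwise (Zpos (odd_part p))) = true ->
    has_representation (Zpos p) (S (S r))).
  { intros p H. apply representation_odd_part.
    destruct (Z.ltb_spec (Zpos (odd_part p)) B) as [L | L]; [| auto].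
    destruct (HE (Zpos (odd_part p))) as [H' | H']; [lia | | exact H'].
    apply mem_set_of in H'. simpl in H'. rewrite H' in H. discriminate. }
  destruct z as [|p|p]; simpl; intros H.
  - apply representation_zero.
  - auto.
  - apply (representation_opp (Zpos p)). auto.
Qed.

(** Decides quotients beyond the range of the list of exceptions by one more descent. Depth 10 holds
    the nonzero residues modulo 864 < 2^10. *)
Definition direct (K : Z) (cfg : config) (good : Z -> bool) : Z -> bool :=
  let row := tabulate 10 (tests cfg) in
  let ks := strides K cfg in
  fun z => let (w, r) := Z.div_eucl z K in hit good (row r) (map (fun k => k * w) ks).

Lemma direct_sound (r : nat) (K : Z) (cfg : config) (good : Z -> bool) (z : Z) :
  0 < K -> (forall z, good z = true -> has_representation z r) -> valid K cfg ->
  direct K cfg good z = true -> has_representation z (S r).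
Proof.
  intros HK Hg Hv. unfold direct.
  assert (Hw := Z_div_mod z K (Z.lt_gt _ _ HK)).
  destruct (Z.div_eucl z K) as [w d]. destruct Hw as [-> _]. rewrite tabulate_eq. intros H.
  rewrite Z.add_comm. now apply hit_sound with good cfg.
Qed.

(* The terms +-3^b with b < 8 are absent at m = 32: they are the c through which
   the candidates n = c + 32 q arise. *)
Definition config4 : config := configure
  [(32, 0, powers 6 3 (3 ^ 8)); (27, 0, powers 21 2 1); (16, 32, powers 14 3 1);
   (32, 0, powers 2 3 (3 ^ 14)); (27, 0, powers 3 2 (2 ^ 21)); (9, 27, powers 21 2 1);
   (8, 16, powers 14 3 1); (16, 32, powers 1 3 (3 ^ 14)); (9, 27, powers 2 2 (2 ^ 21));
   (27, 0, powers 3 2 (2 ^ 24)); (9, 27, powers 2 2 (2 ^ 23)); (4, 8, powers 14 3 1);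
   (3, 9, powers 21 2 1); (32, 0, powers 1 3 (3 ^ 16))].

(** The arguments of [direct] do not arise as c + 32 q from exceptional q, so the terms +-3^b with b
    < 8 are restored at m = 32. *)
Definition config4' : config := configure [(32, 0, powers 8 3 1)] ++ config4.

(** Here the candidates arise as c + 64 q with c = +-3^b and b < 16, so these terms are absent at m
    = 64. *)
Definition config5 : config := configure
  [(81, 0, powers 27 2 1); (64, 0, powers 4 3 (3 ^ 16)); (32, 64, powers 20 3 1);
   (27, 81, powers 31 2 1); (81, 0, powers 5 2 (2 ^ 27)); (16, 32, powers 20 3 1);
   (9, 27, powers 31 2 1); (8, 16, powers 20 3 1); (3, 9, powers 31 2 1); (4, 8, powers 20 3 1)].

(** * Exceptions for sums of four and five terms *)

Lemma valid_config4 : valid (32 * 27) config4.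
Proof. apply valid_configure. reflexivity. Qed.

Lemma valid_config4' : valid 864 config4'.
Proof. apply valid_app; [apply valid_configure; reflexivity | apply valid_config4]. Qed.

Lemma valid_config5 : valid (64 * 81) config5.
Proof. apply valid_configure. reflexivity. Qed.

(** A round number above (326552783 + 3^15) / 64, which bounds the q = (n - c) / 64 of the descent
    for five terms. *)
Definition bound4 : Z := 5330000.

Definition bad4 (s3 : PositiveSet.t) (E : list Z) : list Z :=
  exceptions 32 27 (signs (powers 8 3 1)) config4 (covers s3) bound4 E.

Lemma bad4_spec (s3 : PositiveSet.t) (E : list Z) (n : Z) :
  represents 3 s3 -> forallb (Z.leb 4985) E = true ->
  (forall q, 0 <= q < 166632 -> In q E \/ has_representation q 3) ->
  0 < n < bound4 -> n mod 2 <> 0 -> n mod 3 <> 0 ->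
  In n (bad4 s3 E) \/ has_representation n 4.
Proof.
  intros Hs Hlo HE Hn. apply exceptions_spec with (B := 166632) (lo := 4985); auto; try lia.
  - intros z. now apply covers_sound.
  - apply valid_config4.
  - now apply smooth_spec.
  - now exists 144.
  - intros c Hc. split.
    + revert Hc. apply in_signs. intros y.
      apply two_three_integer_powers; auto using two_three_integer_1, two_three_integer_3.
    (* As |c| <= 3^7, the quotients (n - c) / 32 stay below 166632; the second bound serves negative
       quotients. *)
    + assert (K : forallb (fun c => (bound4 - c <=? 32 * 166632) && (c <=? 32 * 4985))
        (signs (powers 8 3 1)) = true) by reflexivity.
      rewrite forallb_forall in K. specialize (K c Hc).
      apply andb_true_iff in K as [K1 K2]. now apply Z.leb_le in K1, K2.
  (* 3 has order 8 modulo 32 and -1 is not one of its powers, so the sixteen +-3^b with b < 8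
     exhaust the odd residues. Modulo 64 the order is 16. *)
  - intros m. apply odd_residues; reflexivity.
Qed.

Definition bad5 (s3 : PositiveSet.t) (E : list Z) : list Z :=
  exceptions 64 81 (signs (powers 16 3 1)) config5
    (good_below bound4 (set_of E) (direct 864 config4' (covers s3))) 326552783 E.

Lemma bad5_spec (s3 : PositiveSet.t) (E : list Z) (n : Z) :
  represents 3 s3 -> forallb (Z.leb 638809) E = true ->
  (forall q, 0 <= q < bound4 -> In q E \/ has_representation q 4) ->
  0 < n < 326552783 -> n mod 2 <> 0 -> n mod 3 <> 0 ->
  In n (bad5 s3 E) \/ has_representation n 5.
Proof.
  intros Hs Hlo HE Hn. unfold bad5.
  apply exceptions_spec with (B := bound4) (lo := 638809); auto; try (unfold bound4; lia).
  - intros z. apply good_below_sound; [exact HE |].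
    intros y. apply direct_sound; [reflexivity | | apply valid_config4'].
    intros x. now apply covers_sound.
  - apply valid_config5.
  - now apply smooth_spec.
  - now exists 864.
  - intros c Hc. split.
    + revert Hc. apply in_signs. intros y.
      apply two_three_integer_powers; auto using two_three_integer_1, two_three_integer_3.
    + assert (K : forallb (fun c => (326552783 - c <=? 64 * bound4) && (c <=? 64 * 638809))
        (signs (powers 16 3 1)) = true) by reflexivity.
      rewrite forallb_forall in K. specialize (K c Hc).
      apply andb_true_iff in K as [K1 K2]. now apply Z.leb_le in K1, K2.
  - intros m. apply odd_residues; reflexivity.
Qed.

(* Representations of 638809, 326100283 and 325709039, which the tests miss. *)
Definition witnesses : list (list Z) :=
  [[43046721; 24; -40310784; -2097152];
   [2187; -76527504; 64; 402653184; -27648];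
   [-81; -8264970432; -1536; 746496; 8589934592]].

Definition witnessed (r : nat) (n : Z) : bool :=
  existsb (fun l =>
    if fold_right Z.add 0 l =? n then forallb smooth l && (length l =? r)%nat else false) witnesses.

Lemma witnessed_sound (r : nat) (n : Z) : witnessed r n = true -> has_representation n r.
Proof.
  unfold witnessed. intros H. apply existsb_exists in H as [l [_ H]].
  destruct (Z.eqb_spec (fold_right Z.add 0 l) n) as [E | _]; [| discriminate].
  apply andb_true_iff in H as [H L]. apply Nat.eqb_eq in L. exists l. repeat split; auto.
  apply Forall_forall. intros x Hx. rewrite forallb_forall in H. now apply smooth_spec, H.
Qed.

(** Members of l4 from 641687 on may be true exceptions and stay without a witness, whereas every
    candidate left for five terms must have one. *)
Definition upper_bounds : bool :=
  let s2 := pair_sums (2 ^ 21) (smooth_up_to 4000000) in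
  let s3 := add_odd_terms (powers 14 3 1) s2 in
  let E3 := missing (covers s3) 166632 in
  let l4 := bad4 s3 E3 in
  let E4 := smooth_multiples bound4 l4 in
  forallb (Z.leb 103) (missing (covers s2) 103) &&
  (forallb (Z.leb 4985) E3 && (forallb (Z.leb 638809) E4 &&
  (forallb (fun n => if 641687 <=? n then true else witnessed 4 n) l4 &&
   forallb (witnessed 5) (bad5 s3 E4)))).

Lemma upper_bounds_sound : upper_bounds = true ->
  (forall k, 0 < k < 103 -> has_representation k 2) /\
  (forall k, 0 < k < 4985 -> has_representation k 3) /\
  (forall k, 0 < k < 641687 -> has_representation k 4) /\
  (forall k, 0 < k < 326552783 -> has_representation k 5).
Proof.
  unfold upper_bounds.
  assert (R2 : represents 2 (pair_sums (2 ^ 21) (smooth_up_to 4000000))).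
  { apply represents_pair_sums. intros x. apply smooth_up_to_spec. }
  revert R2. generalize (pair_sums (2 ^ 21) (smooth_up_to 4000000)). intros s2 R2.
  assert (R3 : represents 3 (add_odd_terms (powers 14 3 1) s2)).
  { apply represents_add_odd_terms; [| exact R2]. intros x.
    apply two_three_integer_powers; auto using two_three_integer_1, two_three_integer_3. }
  revert R3. generalize (add_odd_terms (powers 14 3 1) s2). intros s3 R3.
  cbv zeta. intros H.
  apply andb_true_iff in H as [H2 H]. apply andb_true_iff in H as [H3 H].
  apply andb_true_iff in H as [H4 H]. apply andb_true_iff in H as [H5 H6].
  assert (C3 := fun q => missing_spec (covers s3) 166632 q).
  revert H3 H4 H5 H6 C3. generalize (missing (covers s3) 166632). intros E3 H3 H4 H5 H6 C3.
  assert (C3' : forall q, 0 <= q < 166632 -> In q E3 \/ has_representation q 3).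
  { intros q Hq. destruct (C3 q Hq) as [K | K]; [now left | right].
    now apply covers_sound with s3. }
  assert (C4 := fun n => bad4_spec s3 E3 n R3 H3 C3').
  revert H4 H5 H6 C4. generalize (bad4 s3 E3). intros l4 H4 H5 H6 C4.
  (* From integers prime to 6 to all q: the part of q prime to 6 is represented or belongs to l4. *)
  assert (C4' : forall q, 0 <= q < bound4 ->
    In q (smooth_multiples bound4 l4) \/ has_representation q 4).
  { intros q [Hq L]. destruct (Z.eq_dec q 0) as [-> | N]; [right; apply representation_zero |].
    destruct (two_three_part q) as (i & j & p & Hi & Hj & Hp & E & P2 & P3); [lia |].
    rewrite E in *. destruct (C4 p) as [K | K]; auto; [lia | |].
    - left. apply in_smooth_multiples; auto; [lia | discriminate].
    - right. rewrite Z.mul_assoc. apply representation_mul; [| exact K].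
      now apply two_three_integer_2_3. }
  assert (C5 := fun n => bad5_spec s3 _ n R3 H4 C4').
  rewrite forallb_forall in H2, H3, H5, H6.
  split; [| split; [| split]].
  - intros k Hk. destruct (missing_spec (covers s2) 103 k) as [K | K]; [lia | |].
    + apply H2, Z.leb_le in K. lia.
    + now apply covers_sound with s2.
  - intros k Hk. destruct (C3' k) as [K | K]; [lia | | exact K].
    apply H3, Z.leb_le in K. lia.
  - apply representation_of_coprime. intros p Hp P2 P3.
    destruct (C4 p) as [K | K]; auto; [unfold bound4; lia |].
    specialize (H5 p K). cbv beta in H5. destruct (Z.leb_spec 641687 p) as [L | L]; [lia |].
    now apply witnessed_sound.
  - apply representation_of_coprime. intros p Hp P2 P3.
    destruct (C5 p) as [K | K]; auto. now apply witnessed_sound, H6.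
Qed.

(** * Classes of terms *)

(** Successive refinements of classes of integers: edges at depth i carry residues modulo the i-th
    modulus, and x fits the tree if some path carries all its residues. *)
Inductive tree := Branch (l : list (Z * tree)).

Definition children (t : tree) : list (Z * tree) := let (l) := t in l.

Fixpoint fits (ps : list Z) (x : Z) (t : tree) : Prop :=
  match ps with
  | [] => True
  | p :: ps => exists u, In (x mod p, u) (children t) /\ fits ps x u
  end.

(* A pair (i, A) stands for the exponents i + A k, k >= 0.  The period A is
   multiplied by f, and exponents below u become classes of their own, with period 0. *)
Definition subclasses (f : nat) (u : Z) (e : Z * Z) : list (Z * Z) :=
  let (i, A) := e in
  if A =? 0 then [e] else
  let A' := Z.of_nat f * A in
  flat_map (fun j =>
    let i' := i + Z.of_nat j * A in
    if i' <? u then [(i', 0); (i' + A', A')] else [(i', A')]) (seq 0 f).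

Definition in_class (e : Z) (c : Z * Z) : Prop :=
  exists k, 0 <= k /\ e = fst c + snd c * k.

(** Divide k by f: the remainder j selects the subclass and the quotient becomes the new parameter.
    As u <= A', what is left after splitting off an exponent below u starts at u or later. *)
Lemma subclasses_spec (f : nat) (u A e : Z) (c : Z * Z) :
  let A' := Z.of_nat f * A in
  0 < A' -> u <= A' -> 0 <= fst c -> snd c = 0 \/ snd c = A -> in_class e c ->
  exists c', In c' (subclasses f u c) /\ in_class e c' /\ 0 <= fst c' /\
    (snd c' = 0 \/ snd c' = A' /\ u <= fst c').
Proof.
  intros A' HA Hu Hi Hc [k [Hk E]]. destruct c as [i B]. simpl in *. unfold subclasses.
  destruct (Z.eqb_spec B 0) as [-> | NB].
  - exists (i, 0). simpl. repeat split; auto. exists k. auto.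
  - destruct Hc as [| ->]; [contradiction |]. fold A'.
    assert (Hf : 0 < Z.of_nat f) by (destruct f; simpl in *; lia).
    assert (A0 : 0 < A) by nia.
    assert (Hd := Z_div_mod_eq_full k (Z.of_nat f)).
    assert (Hm := Z.mod_pos_bound k (Z.of_nat f) Hf).
    assert (Hq := Z.div_pos k (Z.of_nat f) Hk Hf).
    set (j := k mod Z.of_nat f) in *. set (q := k / Z.of_nat f) in *.
    assert (E' : e = (i + j * A) + A' * q) by (unfold A'; rewrite E, Hd; ring).
    assert (Hj : 0 <= j * A) by nia.
    assert (K : forall c', In c' (if i + j * A <? u then [(i + j * A, 0); (i + j * A + A', A')]
        else [(i + j * A, A')]) ->
      In c' (flat_map (fun j => let i' := i + Z.of_nat j * A in
        if i' <? u then [(i', 0); (i' + A', A')] else [(i', A')]) (seq 0 f))).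
    { intros c' H. apply in_flat_map. exists (Z.to_nat j). rewrite in_seq, Z2Nat.id by lia.
      split; [lia | exact H]. }
    destruct (Z.ltb_spec (i + j * A) u) as [L | L].
    + destruct (Z.eq_dec q 0) as [Q | Q].
      * exists (i + j * A, 0). split; [apply K; now left |]. simpl.
        repeat split; [| lia | now left]. exists 0. simpl. split; [lia |]. rewrite E', Q. ring.
      * exists (i + j * A + A', A'). split; [apply K; right; now left |]. simpl.
        repeat split; [| lia | right; lia]. exists (q - 1). simpl. split; [lia |]. rewrite E'. ring.
    + exists (i + j * A, A'). split; [apply K; now left |]. simpl.
      repeat split; [| lia | right; lia]. exists q. auto.
Qed.

(* At each level (f, u, p) of [lv], the exponent classes are refined as in [subclasses],
   and a child carries the residue of b^e modulo p, which is constant on its class. *)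
Fixpoint power_tree (b : Z) (lv : list (nat * Z * Z)) (e : Z * Z) : tree :=
  match lv with
  | [] => Branch []
  | (f, u, p) :: lv =>
    Branch (map (fun e => (Zpow_mod b (fst e) p, power_tree b lv e)) (subclasses f u e))
  end.

(** The congruence says that b^e modulo p has period A from e = u on; the preperiod u allows for
    powers of b dividing p. *)
Fixpoint admissible (b A : Z) (lv : list (nat * Z * Z)) : bool :=
  match lv with
  | [] => true
  | (f, u, p) :: lv =>
    let A := Z.of_nat f * A in
    (0 <? A) && ((0 <? p) && ((u <=? A) &&
      ((b ^ u * (b ^ A - 1) mod p =? 0) && admissible b A lv)))
  end.

Lemma pow_class (b u A p i k : Z) :
  0 < p -> 0 <= u <= i -> 0 <= A -> 0 <= k ->
  b ^ u * (b ^ A - 1) mod p = 0 -> b ^ (i + A * k) mod p = b ^ i mod p.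
Proof.
  intros Hp Hu HA Hk H. apply Z.mod_divide in H; [| lia].
  assert (K : (p | b ^ i * (b ^ A - 1))).
  { replace i with (u + (i - u)) by lia. rewrite Z.pow_add_r by lia.
    replace (b ^ u * b ^ (i - u) * (b ^ A - 1)) with (b ^ u * (b ^ A - 1) * b ^ (i - u)) by ring.
    now apply Z.divide_mul_l. }
  pattern k. apply natlike_ind; [| | exact Hk]; clear k Hk.
  - now rewrite Z.mul_0_r, Z.add_0_r.
  - intros k Hk IH. rewrite <- IH. destruct K as [q K].
    replace (i + A * Z.succ k) with (A + (i + A * k)) by ring.
    assert (0 <= A * k) by nia.
    rewrite !Z.pow_add_r by lia.
    replace (b ^ A * (b ^ i * b ^ (A * k))) with
      (b ^ i * b ^ (A * k) + b ^ i * (b ^ A - 1) * b ^ (A * k)) by ring.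
    rewrite K. replace (q * p * b ^ (A * k)) with (q * b ^ (A * k) * p) by ring.
    apply Z_mod_plus_full.
Qed.

Lemma fits_power_tree (b A e : Z) (lv : list (nat * Z * Z)) (c : Z * Z) :
  (forall f u p, In (f, u, p) lv -> 0 <= u) ->
  admissible b A lv = true -> 0 <= fst c -> snd c = 0 \/ snd c = A -> in_class e c ->
  fits (map snd lv) (b ^ e) (power_tree b lv c).
Proof.
  revert A c. induction lv as [|[[f u] p] lv IH]; intros A c Hlv; [simpl; auto |].
  cbn [admissible]. intros Ha Hi Hc He.
  apply andb_true_iff in Ha as [HA Ha]. apply andb_true_iff in Ha as [Hp Ha].
  apply andb_true_iff in Ha as [Hu Ha]. apply andb_true_iff in Ha as [Hb Ha].
  apply Z.ltb_lt in HA, Hp. apply Z.leb_le in Hu. apply Z.eqb_eq in Hb.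
  destruct (subclasses_spec f u A e c HA Hu Hi Hc He) as (c' & Hin & He' & Hi' & Hc').
  cbn [map fits power_tree children snd]. exists (power_tree b lv c'). split.
  - apply in_map_iff. exists c'. split; [| exact Hin]. f_equal.
    rewrite Zpow_mod_correct by lia. destruct He' as [k [Hk ->]].
    destruct Hc' as [-> | [-> Hu']]; [now rewrite Z.add_0_r |]. symmetry.
    apply pow_class with u; auto; [| lia]. split; [| exact Hu'].
    apply Hlv with f p. now left.
  - apply IH with (Z.of_nat f * A); auto; [| tauto].
    intros f' u' p' H. apply Hlv with f' p'. now right.
Qed.

Fixpoint product_tree (s : Z) (ps : list Z) (t2 t3 : tree) : tree :=
  match ps with
  | [] => Branch []
  | p :: ps =>
    Branch (flat_map (fun c => map (fun d =>
      ((s * (fst c * fst d)) mod p, product_tree s ps (snd c) (snd d)))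
      (children t3)) (children t2))
  end.

Lemma fits_product_tree (s x y : Z) (ps : list Z) (t2 t3 : tree) :
  fits ps x t2 -> fits ps y t3 -> fits ps (s * (x * y)) (product_tree s ps t2 t3).
Proof.
  revert t2 t3. induction ps as [|p ps IH]; intros t2 t3; [auto |].
  cbn [fits product_tree children]. intros [u2 [H2 F2]] [u3 [H3 F3]].
  exists (product_tree s ps u2 u3). split; [| auto].
  apply in_flat_map. exists (x mod p, u2). split; [exact H2 |].
  apply in_map_iff. exists (y mod p, u3). split; [| exact H3]. cbn [fst snd]. f_equal.
  rewrite <- Zmult_mod_idemp_r, <- Zmult_mod, Zmult_mod_idemp_r. reflexivity.
Qed.

(* 14348880 = 2^4 3^3 5 7 13 73, 703 = 19 37 and 1649 = 17 97.  The periods of the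
   exponents of 2 and 3 grow from 36 and 12 to 144 and 432. *)
Definition levels2 : list (nat * Z * Z) :=
  [(36%nat, 4, 14348880); (1%nat, 4, 703); (1%nat, 4, 109); (2%nat, 4, 433); (1%nat, 6, 64);
   (2%nat, 6, 1649); (1%nat, 6, 577)].

Definition levels3 : list (nat * Z * Z) :=
  [(12%nat, 3, 14348880); (3%nat, 3, 703); (3%nat, 3, 109); (1%nat, 3, 433); (4%nat, 3, 64);
   (1%nat, 3, 1649); (1%nat, 3, 577)].

Definition moduli : list Z := map snd levels2.

Definition classes : list (Z * tree) :=
  let t2 := power_tree 2 levels2 (0, 1) in
  let t3 := power_tree 3 levels3 (0, 1) in
  children (product_tree 1 moduli t2 t3) ++ children (product_tree (-1) moduli t2 t3).

Lemma classes_spec (M : Z) (ps : list Z) (x : Z) :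
  moduli = M :: ps -> two_three_integer x ->
  exists t, In (x mod M, t) classes /\ fits ps x t.
Proof.
  intros Hm Hx.
  assert (F2 : forall a : nat, fits moduli (2 ^ Z.of_nat a) (power_tree 2 levels2 (0, 1))).
  { intros a. apply fits_power_tree with 1; [| reflexivity | simpl; lia | now right |].
    - intros f u p H. repeat (destruct H as [H | H]; [injection H as <- <- <-; lia |]). destruct H.
    - exists (Z.of_nat a). cbn [fst snd]. lia. }
  assert (F3 : forall a : nat, fits moduli (3 ^ Z.of_nat a) (power_tree 3 levels3 (0, 1))).
  { intros a. change moduli with (map snd levels3).
    apply fits_power_tree with 1; [| vm_compute; reflexivity | simpl; lia | now right |].
    - intros f u p H. repeat (destruct H as [H | H]; [injection H as <- <- <-; lia |]). destruct H.
    - exists (Z.of_nat a). cbn [fst snd]. lia. }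
  unfold classes. cbv zeta. revert F2 F3.
  generalize (power_tree 2 levels2 (0, 1)) (power_tree 3 levels3 (0, 1)). intros t2 t3 F2 F3.
  apply two_three_integer_iff in Hx as (a & b & Hx).
  assert (K := fun s => fits_product_tree s _ _ _ _ _ (F2 a) (F3 b)).
  destruct Hx as [Hx | Hx]; [specialize (K 1) | specialize (K (-1))].
  - replace (1 * (2 ^ Z.of_nat a * 3 ^ Z.of_nat b)) with x in K by lia.
    rewrite Hm in *. destruct K as [t [Ht K]]. exists t. split; [| exact K].
    apply in_app_iff. now left.
  - replace (-1 * (2 ^ Z.of_nat a * 3 ^ Z.of_nat b)) with x in K by lia.
    rewrite Hm in *. destruct K as [t [Ht K]]. exists t. split; [| exact K].
    apply in_app_iff. now right.
Qed.

(** * Sums of classes *)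

(** An element consists of a sum of residues at the current modulus and the subtrees chosen with it,
    which are used at the next modulus. *)
Definition extend (cs : list (Z * list tree)) (t : tree) : list (Z * list tree) :=
  flat_map (fun c => map (fun d => (fst c + fst d, snd d :: snd c)) (children t)) cs.

Fixpoint combinations (ts : list tree) : list (Z * list tree) :=
  match ts with
  | [] => [(0, [])]
  | t :: ts => extend (combinations ts) t
  end.

Definition values (f : Z -> Z) (cs : list (Z * list tree)) : list (Z * list tree) :=
  map (fun c => (f (fst c), snd c)) cs.

Definition meet (k : list tree -> bool) (ys zs : list (Z * list tree)) : bool :=
  forallb (fun c => forallb (fun d =>
    if fst d =? fst c then k (snd d ++ snd c) else true) zs) ys.

(** Sums of at most three residues modulo p <= 1649 are below 2^13. *)
Definition residue (p : Z) : Z -> Z := tabulate 13 (fun x => x mod p).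

Definition coresidue (n p : Z) : Z -> Z := let r := n mod p in tabulate 13 (fun x => (r - x) mod p).

(** Meets in the middle: sums of two terms against n minus the sum of the others. Matches go on to
    the next modulus, and a match that outlives the last modulus yields false, so true certifies
    that no solution exists. *)
Fixpoint search (fs : list ((Z -> Z) * (Z -> Z))) (ts : list tree) : bool :=
  match fs, ts with
  | (f, g) :: fs, t :: t' :: ts =>
    meet (search fs) (values g (combinations ts)) (values f (combinations [t; t']))
  | _, _ => false
  end.

Definition sum (l : list Z) : Z := fold_right Z.add 0 l.

Lemma sum_app (xs ys : list Z) : sum (xs ++ ys) = sum xs + sum ys.
Proof. induction xs; simpl; lia. Qed.

Definition attained (p : Z) (ps : list Z) (xs : list Z) (cs : list (Z * list tree)) : Prop :=
  exists v ts, In (v, ts) cs /\ v mod p = sum xs mod p /\ Forall2 (fits ps) xs ts.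

Lemma attained_extend (p : Z) (ps : list Z) (x : Z) (xs : list Z) (t : tree) cs :
  fits (p :: ps) x t -> attained p ps xs cs -> attained p ps (x :: xs) (extend cs t).
Proof.
  intros [u [Hu F]] (v & ts & Hin & Ev & Hf).
  exists (v + x mod p), (u :: ts). split; [| split; [| now constructor]].
  - apply in_flat_map. exists (v, ts). split; [exact Hin |].
    apply in_map_iff. exists (x mod p, u). auto.
  - simpl. rewrite Zplus_mod_idemp_r, Z.add_comm, Zplus_mod, Ev, <- Zplus_mod. reflexivity.
Qed.

Lemma attained_nil (p : Z) (ps : list Z) : attained p ps [] (combinations []).
Proof. exists 0, []. split; [now left | auto]. Qed.

Lemma attained_combinations (p : Z) (ps : list Z) (xs : list Z) (ts : list tree) :
  Forall2 (fits (p :: ps)) xs ts -> attained p ps xs (combinations ts).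
Proof.
  induction 1; [apply attained_nil | now apply attained_extend].
Qed.

Lemma meet_spec (k : list tree -> bool) (n p : Z) (ps : list Z) (xs ys : list Z) cs ds :
  meet k (values (coresidue n p) cs) (values (residue p) ds) = true ->
  attained p ps xs cs -> attained p ps ys ds -> sum ys + sum xs = n ->
  exists ts, Forall2 (fits ps) (ys ++ xs) ts /\ k ts = true.
Proof.
  intros H (v & ts & Hin & Ev & Hf) (v' & ts' & Hin' & Ev' & Hf') E.
  exists (ts' ++ ts). split; [now apply Forall2_app |].
  unfold meet in H. rewrite forallb_forall in H.
  specialize (H (coresidue n p v, ts)). simpl in H. rewrite forallb_forall in H.
  specialize (H ltac:(apply in_map_iff; exists (v, ts); auto) (residue p v', ts')
    ltac:(apply in_map_iff; exists (v', ts'); auto)). simpl in H.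
  unfold residue, coresidue in H. cbv zeta in H. rewrite !tabulate_eq in H.
  rewrite Zminus_mod_idemp_l, Zminus_mod, Ev, <- Zminus_mod, Ev', <- E in H.
  replace (sum ys + sum xs - sum xs) with (sum ys) in H by ring.
  now rewrite Z.eqb_refl in H.
Qed.

Lemma search_spec (n : Z) (ps : list Z) (xs : list Z) (ts : list tree) :
  search (map (fun p => (residue p, coresidue n p)) ps) ts = true ->
  Forall2 (fits ps) xs ts -> sum xs <> n.
Proof.
  revert xs ts. induction ps as [|p ps IH]; intros xs ts H F E; [destruct ts; discriminate |].
  destruct ts as [|t [|t' ts]]; try discriminate. cbn [map search] in H.
  inversion F as [|x y xs' ? Fx F']; subst. inversion F' as [|x' y' xs'' ? Fx' F'']; subst.
  apply meet_spec with (xs := xs'') (ys := [x; x']) (ps := ps) in H.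
  - destruct H as [us [Hf H]]. now apply (IH _ _ H Hf).
  - now apply attained_combinations.
  - apply attained_combinations. auto.
  - simpl. lia.
Qed.

(** * Enumeration of tuples of classes at the first modulus *)

Inductive entry := Entry (d : Z) (pos : positive) (r : Z) (t : tree).

(** Moves the least divisible residues to the front, so that the tails of the list have large gcds
    and the divisibility test in [prefixes] prunes early. *)
Fixpoint bucket (ms : list Z) (l : list (Z * tree)) : list (Z * tree) :=
  match ms with
  | [] => l
  | m :: ms => let (a, b) := partition (fun c => fst c mod m =? 0) l in b ++ bucket ms a
  end.

Lemma in_bucket (ms : list Z) (l : list (Z * tree)) c : In c l -> In c (bucket ms l).
Proof.
  revert l. induction ms as [|m ms IH]; simpl; intros l H; [exact H |].
  destruct (partition _ l) as [a b] eqn:E. apply in_app_iff.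
  destruct (elements_in_partition _ _ E c) as [K _]. destruct (K H) as [K' | K']; auto.
Qed.

(* d is the gcd of M and of all residues from this entry on, and pos decreases
   along the list. *)
Fixpoint annotate (M : Z) (l : list (Z * tree)) : list entry :=
  match l with
  | [] => []
  | (r, t) :: l =>
    let es := annotate M l in
    match es with
    | [] => [Entry (Z.gcd r M) 1 r t]
    | Entry d pos _ _ :: _ => Entry (Z.gcd r d) (Pos.succ pos) r t :: es
    end
  end.

Definition position_of (e : entry) : positive := let (_, pos, _, _) := e in pos.

Definition matches (M : Z) (ps : list Z) (x : Z) (e : entry) : Prop :=
  let (_, _, r, t) := e in r = x mod M /\ fits ps x t.

Fixpoint sorted (M : Z) (es : list entry) : Prop :=
  match es with
  | [] => True
  | Entry d pos r t :: es' =>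
    (d | M) /\ (forall e, In e es -> (position_of e <= pos)%positive /\
      (d | let (_, _, r', _) := e in r')) /\ sorted M es'
  end.

Lemma sorted_annotate (M : Z) (l : list (Z * tree)) : sorted M (annotate M l).
Proof.
  induction l as [|[r t] l IH]; simpl; [exact I |].
  destruct (annotate M l) as [|[d pos r' t'] es].
  - simpl. split; [apply Z.gcd_divide_r |]. split; [| exact I].
    intros e [<- | []]. simpl. split; [lia | apply Z.gcd_divide_l].
  - simpl. simpl in IH. destruct IH as [I1 [I2 I3]].
    assert (D : (Z.gcd r d | d)) by apply Z.gcd_divide_r.
    split; [now apply Z.divide_trans with d |]. split; [| auto].
    intros e [<- | He]; [simpl; split; [lia | apply Z.gcd_divide_l] |].
    destruct (I2 e He) as [J1 J2]. split; [lia |]. now apply Z.divide_trans with d.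
Qed.

Lemma in_annotate (M r : Z) (t : tree) (l : list (Z * tree)) :
  In (r, t) l -> exists d pos, In (Entry d pos r t) (annotate M l).
Proof.
  induction l as [|[r' t'] l IH]; simpl; [tauto |]. intros [H | H].
  - injection H as -> ->. destruct (annotate M l) as [|[d pos ? ?] es]; do 2 eexists; now left.
  - destruct (IH H) as (d & pos & K). exists d, pos.
    destruct (annotate M l) as [|[d' pos' ? ?] es]; [destruct K | now right].
Qed.

Lemma sorted_app (M : Z) (l1 l2 : list entry) : sorted M (l1 ++ l2) -> sorted M l2.
Proof. induction l1 as [|[d pos r t] l1 IH]; simpl; [auto | tauto]. Qed.

Definition sub_mod (M y r : Z) : Z :=
  match y - r with Zneg q => Zneg q + M | d => d end.

Lemma sub_mod_spec (M y r : Z) : 0 <= y < M -> 0 <= r < M ->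
  0 <= sub_mod M y r < M /\ sub_mod M y r mod M = (y - r) mod M.
Proof.
  intros Hy Hr. unfold sub_mod. destruct (y - r) as [|q|q] eqn:E.
  - split; [lia | reflexivity].
  - split; [lia | reflexivity].
  - split; [lia |]. rewrite <- (Z.mul_1_l M) at 1. apply Z_mod_plus_full.
Qed.

Definition add_mod (M r r' : Z) : Z :=
  match r + r' - M with Zneg _ => r + r' | d => d end.

Lemma add_mod_spec (M r r' : Z) : 0 <= r < M -> 0 <= r' < M ->
  add_mod M r r' = (r + r') mod M.
Proof.
  intros Hr Hr'. unfold add_mod. destruct (r + r' - M) as [|q|q] eqn:E.
  - replace (r + r') with (0 + 1 * M) by lia. rewrite Z_mod_plus_full. symmetry. apply Z.mod_small. lia.
  - replace (r + r') with (Zpos q + 1 * M) by lia. rewrite Z_mod_plus_full. symmetry. apply Z.mod_small. lia.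
  - symmetry. apply Z.mod_small. lia.
Qed.

Lemma match_head_or_tail (M : Z) (ps : list Z) (e : entry) (es : list entry) (xs : list Z) :
  (forall x, In x xs -> exists e', In e' (e :: es) /\ matches M ps x e') ->
  (exists xs1 x xs2, xs = xs1 ++ x :: xs2 /\ matches M ps x e) \/
  (forall x, In x xs -> exists e', In e' es /\ matches M ps x e').
Proof.
  induction xs as [|x xs IH]; intros H; [right; now intros |].
  destruct IH as [(xs1 & y & xs2 & -> & Hy) | IH].
  - intros y Hy. apply H. now right.
  - left. now exists (x :: xs1), y, xs2.
  - destruct (H x) as [e' [[<- | He] Hm]]; [now left | left; now exists [], x, xs | right].
    intros y [<- | Hy]; [now exists e' | auto].
Qed.

Lemma divide_of_mod_eq (d M y s : Z) : (d | M) -> (d | s) -> y mod M = s mod M -> (d | y).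
Proof.
  intros HM Hs E. destruct (Z.eq_dec M 0) as [-> | N]; [now rewrite !Zmod_0_r in E; subst |].
  rewrite (Z.div_mod y M N), E. apply Z.divide_add_r; [now apply Z.divide_mul_l |].
  rewrite Z.mod_eq by exact N. apply Z.divide_sub_r; [exact Hs | now apply Z.divide_mul_l].
Qed.

Lemma residue_sum_divisible (M d : Z) (ps : list Z) (es : list entry) (xs : list Z) :
  (d | M) -> (forall e, In e es -> (d | let (_, _, r, _) := e in r)) ->
  (forall x, In x xs -> exists e, In e es /\ matches M ps x e) -> (d | sum xs).
Proof.
  intros HM Hes H. induction xs as [|x xs IH]; [apply Z.divide_0_r |].
  simpl. apply Z.divide_add_r; [| apply IH; intros y Hy; apply H; now right].
  destruct (H x) as [[d' pos r t] [He [Hr _]]]; [now left |].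
  apply Hes in He. subst r.
  destruct (Z.eq_dec M 0) as [-> | N]; [now rewrite Zmod_0_r in He |].
  rewrite (Z.div_mod x M N). apply Z.divide_add_r; [now apply Z.divide_mul_l | exact He].
Qed.

Lemma test_true (d d' y : Z) : (d | y) -> (if d =? d' then true else y mod d =? 0) = true.
Proof.
  intros H. destruct (d =? d'); [reflexivity |]. apply Z.eqb_eq.
  destruct (Z.eq_dec d 0) as [-> | N]; [| now apply Z.mod_divide].
  rewrite Zmod_0_r. now apply Z.divide_0_l.
Qed.

(* The non-decreasing choices of k classes which can be followed by two classes
   with sum y modulo M: the remaining sum must be divisible by d, and d' was already tested. *)
Fixpoint prefixes (M : Z) (k : nat) : list entry -> Z -> Z -> list (Z * list tree) ->
    list (Z * (positive * list (Z * list tree))) :=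
  match k with
  | O => fun l y d' cs =>
    match l with
    | [] => []
    | Entry d pos _ _ :: _ =>
      if (if d =? d' then true else y mod d =? 0) then [(y, (pos, cs))] else []
    end
  | S k => fix loop l y d' cs :=
    match l with
    | [] => []
    | Entry d pos r t :: l' =>
      if (if d =? d' then true else y mod d =? 0)
      then prefixes M k l (sub_mod M y r) d (extend cs t) ++ loop l' y d cs
      else []
    end
  end.

Lemma prefixes_spec (M p : Z) (ps : list Z) (k : nat) (es : list entry) (y d' : Z) cs (zs xs : list Z) :
  0 < M -> sorted M es -> 0 <= y < M -> y mod M = sum xs mod M -> length xs = S (S k) ->
  (forall x, In x xs -> exists e, In e es /\ matches M (p :: ps) x e) -> attained p ps zs cs ->
  exists y' pos cs' zs' a b es1 es2,
    In (y', (pos, cs')) (prefixes M k es y d' cs) /\ attained p ps zs' cs' /\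
    sum zs' + (a + b) = sum zs + sum xs /\ y' = (a + b) mod M /\ es = es1 ++ es2 /\
    (forall e, In e es2 -> (position_of e <= pos)%positive) /\
    (exists e, In e es2 /\ matches M (p :: ps) a e) /\
    (exists e, In e es2 /\ matches M (p :: ps) b e).
Proof.
  intros HM. revert es y d' cs zs xs.
  (* Pruning loses no solution: d divides M and all residues still available, hence the sum of the
     remaining terms, and hence y. *)
  assert (T : forall es y d d' pos r t xs, sorted M (Entry d pos r t :: es) ->
    y mod M = sum xs mod M ->
    (forall x, In x xs -> exists e, In e (Entry d pos r t :: es) /\ matches M (p :: ps) x e) ->
    (if d =? d' then true else y mod d =? 0) = true).
  { intros es y d d' pos r t xs [Hd [He _]] Ey Hx. apply test_true.
    apply divide_of_mod_eq with M (sum xs); [exact Hd | | exact Ey].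
    apply residue_sum_divisible with M (p :: ps) (Entry d pos r t :: es); [exact Hd | | exact Hx].
    intros e H. now apply He. }
  induction k as [|k IHk].
  - intros es y d' cs zs xs Hs Hy Ey Hl Hx Hc.
    destruct xs as [|a [|b [|]]]; try discriminate.
    destruct es as [|[d pos r t] es]; [destruct (Hx a (or_introl eq_refl)) as [e [[] _]] |].
    cbn [prefixes]. rewrite (T es y d d' pos r t _ Hs Ey Hx).
    exists y, pos, cs, zs, a, b, [], (Entry d pos r t :: es).
    split; [now left |]. split; [exact Hc |]. split; [simpl; lia |].
    split; [rewrite <- (Z.mod_small y M Hy), Ey; simpl; f_equal; lia |].
    split; [reflexivity |]. split; [intros e He; now apply Hs |].
    split; apply Hx; simpl; auto.
  - intros es. induction es as [|[d pos r t] es IHes]; intros y d' cs zs xs Hs Hy Ey Hl Hx Hc.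
    { destruct xs as [|x xs]; [discriminate |].
      destruct (Hx x (or_introl eq_refl)) as [e [[] _]]. }
    assert (Ht := T es y d d' pos r t xs Hs Ey Hx).
    cbn [prefixes]. rewrite Ht.
    destruct (match_head_or_tail _ _ _ _ _ Hx) as [(xs1 & x & xs2 & -> & [Er F]) | Hx'].
    (* The head class is used for x and stays available, since classes may repeat. *)
    + rewrite sum_app in Ey. simpl in Ey.
      destruct (sub_mod_spec M y r Hy) as [B1 B2]; [subst r; apply Z.mod_pos_bound; lia |].
      destruct (IHk (Entry d pos r t :: es) (sub_mod M y r) d (extend cs t) (x :: zs) (xs1 ++ xs2))
        as (y' & pos' & cs' & zs' & a & b & es1 & es2 & Hin & H1 & H2 & H); auto.
      * rewrite B2, Er, Zminus_mod_idemp_r, Zminus_mod, Ey, <- Zminus_mod, sum_app. f_equal. ring.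
      * rewrite length_app in *. simpl in Hl. lia.
      * intros z Hz. apply Hx. apply in_app_iff in Hz. apply in_app_iff. simpl. tauto.
      * now apply attained_extend.
      * exists y', pos', cs', zs', a, b, es1, es2. split; [apply in_app_iff; now left |].
        split; [exact H1 |]. split; [| exact H]. rewrite H2, !sum_app. simpl. ring.
    + destruct (IHes y d cs zs xs)
        as (y' & pos' & cs' & zs' & a & b & es1 & es2 & Hin & H1 & H2 & H3 & H4 & H); auto.
      { now apply sorted_app with (l1 := [Entry d pos r t]). }
      exists y', pos', cs', zs', a, b, (Entry d pos r t :: es1), es2.
      split; [apply in_app_iff; now right |]. rewrite H4. auto.
Qed.

(** [Z.to_pos] gives the residues 0 and 1 the same key. This only makes some queries face additional
    pairs, which is harmless for soundness. *)
Definition find_all {A} (y : Z) (m : PositiveMap.t (list A)) : list A :=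
  match PositiveMap.find (Z.to_pos y) m with Some l => l | None => [] end.

Definition insert_at {A} (y : Z) (a : A) (m : PositiveMap.t (list A)) : PositiveMap.t (list A) :=
  PositiveMap.add (Z.to_pos y) (a :: find_all y m) m.

Definition index {A} (l : list (Z * A)) : PositiveMap.t (list A) :=
  fold_left (fun m c => insert_at (fst c) (snd c) m) l (PositiveMap.empty (list A)).

Lemma find_all_insert_at {A} (y z : Z) (a b : A) (m : PositiveMap.t (list A)) :
  In b (find_all z m) \/ y = z /\ a = b -> In b (find_all z (insert_at y a m)).
Proof.
  unfold insert_at. unfold find_all at 2.
  destruct (Pos.eq_dec (Z.to_pos z) (Z.to_pos y)) as [E | N].
  - rewrite E, PositiveMap.gss. unfold find_all. rewrite E. simpl. tauto.
  - rewrite PositiveMap.gso by exact N. intros [H | [-> _]]; [exact H | now destruct N].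
Qed.

Lemma find_all_index {A} (l : list (Z * A)) (y : Z) (a : A) :
  In (y, a) l -> In a (find_all y (index l)).
Proof.
  intros H. unfold index.
  enough (K : forall m, In (y, a) l \/ In a (find_all y m) ->
    In a (find_all y (fold_left (fun m c => insert_at (fst c) (snd c) m) l m))) by auto.
  clear H. induction l as [|c l IH]; intros m H; simpl; [now destruct H |].
  apply IH. destruct H as [[-> | H] | H]; [| auto |]; right; apply find_all_insert_at; auto.
Qed.

(* (pos, (k, cs)): the refinements cs of a prefix of classes, which remains to be followed
   by two classes of position at most pos; k continues the search. *)
Definition query : Type := positive * ((list tree -> bool) * list (Z * list tree)).

Definition answer (f : Z -> Z) (pos : positive) (t t' : tree) (qs : list query) : bool :=
  match qs with
  | [] => true
  | _ =>
    let zs := values f (combinations [t; t']) in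
    forallb (fun q : query =>
      if (pos <=? fst q)%positive then meet (fst (snd q)) (snd (snd q)) zs else true) qs
  end.

(** Each unordered pair of classes is formed once for all queries. Positions decrease along the
    list, so the first class of a pair has the larger one, and comparing it with the bound of the
    query is enough. *)
Fixpoint pairs (M : Z) (f : Z -> Z) (m : PositiveMap.t (list query)) (l : list entry) : bool :=
  match l with
  | [] => true
  | Entry _ pos r t :: l' =>
    if forallb (fun e : entry => let (_, _, r', t') := e in
      answer f pos t t' (find_all (add_mod M r r') m)) l
    then pairs M f m l' else false
  end.

Lemma pairs_spec (M : Z) (f : Z -> Z) (m : PositiveMap.t (list query)) (l1 l2 : list entry)
    (d pos d' pos' : _) (r r' : Z) (t t' : tree) (q : query) :
  pairs M f m (l1 ++ Entry d pos r t :: l2) = true ->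
  In (Entry d' pos' r' t') (Entry d pos r t :: l2) ->
  In q (find_all (add_mod M r r') m) -> (pos <= fst q)%positive ->
  meet (fst (snd q)) (snd (snd q)) (values f (combinations [t; t'])) = true.
Proof.
  intros H He Hq Hp. induction l1 as [|[? ? ? ?] l1 IH].
  - cbn [app pairs] in H. destruct (forallb _ _) eqn:E; [| discriminate].
    rewrite forallb_forall in E. specialize (E _ He). simpl in E.
    destruct (find_all (add_mod M r r') m) as [|q0 qs]; [destruct Hq |].
    unfold answer in E. rewrite forallb_forall in E. specialize (E _ Hq). cbv beta in E.
    apply Pos.leb_le in Hp. now rewrite Hp in E.
  - apply IH. cbn [app pairs] in H. now destruct (forallb _ _).
Qed.

Lemma in_ordered {A} (l : list A) (x y : A) : In x l -> In y l ->
  exists l1 l2, (l = l1 ++ x :: l2 /\ In y (x :: l2)) \/ (l = l1 ++ y :: l2 /\ In x (y :: l2)).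
Proof.
  induction l as [|z l IH]; intros Hx Hy; [destruct Hx |].
  destruct Hx as [-> | Hx]; [exists [], l; left; auto |].
  destruct Hy as [-> | Hy]; [exists [], l; right; simpl; auto |].
  destruct (IH Hx Hy) as (l1 & l2 & [[-> H] | [-> H]]); exists (z :: l1), l2; auto.
Qed.

Definition queries (M p : Z) (ps : list Z) (es : list entry) (n : Z) (k : nat) : list (Z * query) :=
  let g := coresidue n p in
  let continue := search (map (fun p => (residue p, coresidue n p)) ps) in
  map (fun c => (fst c, (fst (snd c), (continue, values g (snd (snd c))))))
    (prefixes M k es (n mod M) 1 (combinations [])).

(** All targets share one index, hence a single pass over the pairs of classes. *)
Definition no_sums (targets : list (Z * nat)) : bool :=
  match moduli with
  | M :: p :: ps =>
    let es := annotate M (bucket [2; 4; 8; 16; 3; 9; 27] classes) in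
    pairs M (residue p)
      (index (flat_map (fun c => queries M p ps es (fst c) (snd c)) targets)) es
  | _ => false
  end.

Lemma no_sums_sound (targets : list (Z * nat)) (n : Z) (k : nat) :
  no_sums targets = true -> In (n, k) targets -> ~ has_representation n (S (S k)).
Proof.
  unfold no_sums. destruct moduli as [|M [|p ps]] eqn:Em; [discriminate Em | discriminate Em |].
  assert (HM : 0 < M) by (injection Em as <- _ _; reflexivity).
  assert (Hcl := fun x => classes_spec M (p :: ps) x Em).
  revert Hcl. generalize classes. intros cl Hcl.
  set (es := annotate M _). intros H Ht [xs [Hl [Hs Hn]]].
  assert (So : sorted M es) by apply sorted_annotate.
  assert (Hx : forall x, In x xs -> exists e, In e es /\ matches M (p :: ps) x e).
  { intros x Hx. rewrite Forall_forall in Hs.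
    destruct (Hcl x (Hs x Hx)) as [t [Hc F]].
    destruct (in_annotate M (x mod M) t (bucket [2; 4; 8; 16; 3; 9; 27] cl))
      as (d & pos & He); [now apply in_bucket |].
    exists (Entry d pos (x mod M) t). split; [exact He |]. now split. }
  clearbody es.
  destruct (prefixes_spec M p ps k es (n mod M) 1 (combinations []) [] xs)
    as (y & pos & cs & zs & a & b & es1 & es2 & Hin & Hc & Esum & Ey & -> & Hpos & Ha & Hb); auto.
  { apply Z.mod_pos_bound. exact HM. }
  { rewrite Zmod_mod. unfold sum. now rewrite Hn. }
  { apply attained_nil. }
  assert (Hq := find_all_index (flat_map (fun c => queries M p ps (es1 ++ es2) (fst c) (snd c)) targets) y
    (pos, (search (map (fun p => (residue p, coresidue n p)) ps), values (coresidue n p) cs))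
    ltac:(apply in_flat_map; exists (n, k); split; [exact Ht |];
      apply in_map_iff; exists (y, (pos, cs)); auto)).
  assert (Hab : sum zs + (a + b) = n) by (rewrite Esum; simpl; unfold sum; lia).
  (* Stated for classes in list order; the other order follows by exchanging a and b. *)
  assert (K : forall a b e e' l1 l2, sum zs + (a + b) = n -> y = (a + b) mod M ->
    matches M (p :: ps) a e -> matches M (p :: ps) b e' -> es2 = l1 ++ e :: l2 ->
    In e' (e :: l2) -> False).
  { clear a b Ha Hb Esum Ey Hab. intros a b [d1 p1 r1 t1] [d2 p2 r2 t2] l1 l2 E Ey [-> F1] [-> F2] E2 He.
    assert (K : meet (search (map (fun p => (residue p, coresidue n p)) ps))
      (values (coresidue n p) cs) (values (residue p) (combinations [t1; t2])) = true).
    { rewrite E2, app_assoc in H.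
      apply (pairs_spec _ _ _ _ _ _ _ _ _ _ _ _ _ (pos, (_, _)) H He).
      - rewrite add_mod_spec by (apply Z.mod_pos_bound; exact HM).
        rewrite <- Zplus_mod, <- Ey, <- app_assoc, <- E2. exact Hq.
      - apply (Hpos (Entry d1 p1 (a mod M) t1)). rewrite E2. apply in_app_iff. simpl. auto. }
    apply meet_spec with (xs := zs) (ys := [a; b]) (ps := ps) in K.
    - destruct K as [ts [Hf K]]. apply (search_spec _ _ _ _ K Hf). simpl. lia.
    - exact Hc.
    - apply attained_combinations. auto.
    - simpl. lia. }
  destruct Ha as [e [He Hae]], Hb as [e' [He' Hbe]].
  destruct (in_ordered es2 e e' He He') as (l1 & l2 & [[E2 L] | [E2 L]]).
  - exact (K a b e e' l1 l2 Hab Ey Hae Hbe E2 L).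
  - apply (K b a e' e l1 l2); auto; [lia | rewrite Ey; f_equal; lia].
Qed.

(** The second component is the number of terms less two: the number of classes chosen before the
    final pair. *)
Definition targets : list (Z * nat) :=
  [(103, 0%nat); (4985, 1%nat); (641687, 2%nat); (326552783, 3%nat)].

(** * The two computations and the values of S *)

Lemma upper_bounds_true : upper_bounds = true.
Proof. vm_cast_no_check (eq_refl true). Qed.

Lemma no_sums_true : no_sums targets = true.
Proof. vm_cast_no_check (eq_refl true). Qed.

Theorem theorem1p2 :
  is_S 3 103 /\ is_S 4 4985 /\ is_S 5 641687 /\ is_S 6 326552783.
Proof.
  destruct (upper_bounds_sound upper_bounds_true) as (H2 & H3 & H4 & H5).
  assert (N : forall n k, In (n, k) targets -> ~ has_representation n (S (S k))).
  { intros n k. apply no_sums_sound, no_sums_true. }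
  split; [| split; [| split]]; apply is_S_intro; auto; try lia; apply N; simpl; auto.
Qed.
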